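(* Let $(\Omega,\mathcal F,\mathbb P)$ be a nonatomic probability space and $0\le p\le\infty$. Let $\mathcal A_\alpha\subset L^p$ be the acceptance set based on Value-at-Risk at level $\alpha\in(0,1)$ and consider a traded asset $S=(S_0,S_T)$. Then $\rho_{\mathcal A_\alpha,S}$ is cash subadditive if and only if $\mathbb P(S_T<S_0)=0$.
   Context: $L^p=L^p(\Omega,\mathcal F,\mathbb P)$ with the almost sure order and positive cone $L^p_+$. $\operatorname{VaR}_\alpha(X)=\inf\{m\in\mathbb R : \mathbb P(X+m<0)\le\alpha\}$ and $\mathcal A_\alpha=\{X\in L^p : \operatorname{VaR}_\alpha(X)\le0\}=\{X\in L^p : \mathbb P(X<0)\le\alpha\}$. A traded asset is a pair $S=(S_0,S_T)$ with $S_0>0$ real and $S_T\in L^p_+$ nonzero. The risk measure is $\rho_{\mathcal A_\alpha,S}(X)=\inf\{m\in\mathbb R : X+\frac{m}{S_0}S_T\in\mathcal A_\alpha\}\in\mathbb R\cup\{\pm\infty\}$ with $\inf\emptyset=\infty$. A function $\rho:L^p\to\mathbb R\cup\{\pm\infty\}$ is cash subadditive if it is decreasing ($X\le Y$ implies $\rho(X)\ge\rho(Y)$) and $\rho(X+\lambda 1_\Omega)\ge\rho(X)-\lambda$ for all $\lambda>0$ and $X\in L^p$ (with $\pm\infty-\lambda=\pm\infty$). *)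

(* Defs.v *)
From HB Require Import structures.
From mathcomp Require Import all_boot all_order all_algebra.
From mathcomp Require Import all_classical all_reals all_analysis.

Set Implicit Arguments.
Unset Strict Implicit.
Unset Printing Implicit Defensive.

Import Order.TTheory GRing.Theory Num.Theory.
Import numFieldNormedType.Exports.

Local Open Scope classical_set_scope.
Local Open Scope ring_scope.

(* L^p is [Lfun P p]: measurable representatives [T -> R] with finite 'N[P]_p,
   compared through the almost sure order.  Everything below depends on a
   representative only through its almost sure class.  For 0 < p < 1 the
   quantity 'N[P]_p is finite exactly when |X|^p is integrable; at p = 0 it is
   always finite (_ `^ 0 = 1), so [Lfun P 0] is the space of all random
   variables: *)
Lemma mem_Lfun0 (R : realType) (d : measure_display) (T : measurableType d)
    (P : probability T R) (X : T -> R) :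
  X \in Lfun P 0%E <-> measurable_fun [set: T] X.
Proof.
split=> [/sub_Lfun_mfun|mX]; first by rewrite inE.
by apply/andP; split; rewrite inE//= /finite_norm unlock /= invr0 poweRe0 ltry.
Qed.

Section value_at_risk.
Context (R : realType) (d : measure_display) (T : measurableType d).
Variables (P : probability T R) (p : \bar R).

Definition nonatomic := forall A : set T, measurable A -> (0 < P A)%E ->
  exists B : set T, [/\ measurable B, B `<=` A, (0 < P B)%E & (P B < P A)%E].

Definition VaR (alpha : R) (X : T -> R) : \bar R :=
  ereal_inf [set m%:E | m in
    [set m : R | (P [set w | (X w + m < 0)%R] <= alpha%:E)%E]].

Definition VaR_acceptance (alpha : R) : set (T -> R) :=
  [set X | X \in Lfun P p /\ (VaR alpha X <= 0)%E].

Record traded_asset := TradedAsset {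
  price : R;
  payoff : T -> R;
  price_gt0 : 0 < price;
  payoff_Lfun : payoff \in Lfun P p;
  payoff_ge0 : {ae P, forall w, 0 <= payoff w};
  payoff_neq0 : ~ {ae P, forall w, payoff w = 0}
}.

Definition risk_measure (A : set (T -> R)) (S : traded_asset) (X : T -> R)
    : \bar R :=
  ereal_inf [set m%:E | m in
    [set m : R | A (fun w => X w + m / price S * payoff S w)]].

(* Only the values of [rho] on L^p matter. *)
Definition cash_subadditive (rho : (T -> R) -> \bar R) :=
  (forall X Y : T -> R, X \in Lfun P p -> Y \in Lfun P p ->
     {ae P, forall w, X w <= Y w} -> (rho Y <= rho X)%E) /\
  (forall (X : T -> R) (lambda : R), X \in Lfun P p -> 0 < lambda ->
     (rho X - lambda%:E <= rho (fun w => X w + lambda)%R)%E).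

End value_at_risk.

(* Main.v *)
(* If [S_T >= S_0] almost surely, adding [l] to the amount invested in [S]
   raises the position by at least [l], whence cash subadditivity. Otherwise
   [B = {S_T + e < S_0}] has positive probability for some [e > 0], and
   nonatomicity yields [C] with [P(C) <= alpha < P(C U B)]. The position
   [X = - 1_(C U B) - K / S_0 * S_T 1_C], with [K = 1 + e / S_0], becomes
   acceptable on adding one unit of cash, which repairs it off [C], whereas an
   investment of less than [K] in [S] leaves it negative on [C U B]: so
   [rho(X + 1) <= 0] and [rho(X) >= K > 1]. *)
Require Import Defs.
From HB Require Import structures.
From mathcomp Require Import all_boot all_order all_algebra.
From mathcomp Require Import all_classical all_reals all_analysis.
From mathcomp Require Import ess_sup_inf measurable_realfun.
From mathcomp Require Import lra.

Set Implicit Arguments.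
Unset Strict Implicit.
Unset Printing Implicit Defensive.

Import Order.TTheory GRing.Theory Num.Theory.
Import numFieldNormedType.Exports.

Local Open Scope classical_set_scope.
Local Open Scope ring_scope.

(** * Monotone limits and almost sure comparison of measures *)

Lemma probability_fineK (R : realType) (d : measure_display)
    (T : measurableType d) (P : probability T R) (A : set T) :
  measurable A -> P A = (fine (P A))%:E.
Proof. by move=> mA; rewrite fineK// fin_num_measure. Qed.

Lemma measure_bigcup_nondecreasing_le (R : realType) (d : measure_display)
    (T : measurableType d) (mu : {measure set T -> \bar R})
    (F : (set T)^nat) (a : \bar R) :
  (forall n, measurable (F n)) -> nondecreasing_seq F ->
  (forall n, mu (F n) <= a)%E -> (mu (\bigcup_n F n) <= a)%E.
Proof.
move=> mF ndF Fa.
have cF := nondecreasing_cvg_mu (mu := mu) mF (bigcupT_measurable F mF) ndF.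
rewrite -(cvg_lim _ cF)//; apply: lime_le; first exact: cvgP cF.
by near=> n; exact: Fa.
Unshelve. all: by end_near. Qed.

Lemma measurable_ltr (R : realType) (d : measure_display)
    (T : measurableType d) (X Y : T -> R) :
  measurable_fun setT X -> measurable_fun setT Y ->
  measurable [set w | X w < Y w].
Proof.
move=> mX mY; rewrite -[X in measurable X]setTI.
exact: (measurable_fun_ltr mX mY measurableT (Y := [set true])).
Qed.

(** Continuity from below along the increasing sets [X + 1/(n+1) < c], whose union is [X < c]. It
    lets a positive slack [e] be removed from a strict inequality. *)
Lemma measure_ltr_le (R : realType) (d : measure_display)
    (T : measurableType d) (mu : {measure set T -> \bar R}) (X : T -> R)
    (c : R) (a : \bar R) : measurable_fun setT X ->
  (forall e : R, (0 < e)%R -> mu [set w | (X w + e < c)%R] <= a)%E ->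
  (mu [set w | (X w < c)%R] <= a)%E.
Proof.
move=> mX Xa.
have -> : [set w | X w < c] = \bigcup_n [set w | X w + n.+1%:R^-1 < c].
  apply/seteqP; split => [w /= Xw|w [n _ /=]].
    by have [n Xn] := ltr_add_invr Xw; exists n.
  by apply: le_lt_trans; rewrite lerDl invr_ge0.
apply: measure_bigcup_nondecreasing_le => [n|m n mn|n].
- by apply: measurable_ltr => //; exact: measurable_funD.
- apply/subsetPset => w /=; apply: le_lt_trans.
  by rewrite lerD2l lef_pV2 ?posrE// ler_nat.
- by apply: Xa; rewrite invr_gt0.
Qed.

(** [A] lies in the union of [B] and the exceptional null set, which has the measure of [B]. *)
Lemma le_measure_ae (R : realType) (d : measure_display)
    (T : measurableType d) (mu : {measure set T -> \bar R}) (A B : set T) :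
  measurable A -> measurable B -> {ae mu, forall w, A w -> B w} ->
  (mu A <= mu B)%E.
Proof.
move=> mA mB [N [mN N0 AB]]; rewrite -(measureU0 mB mN N0).
apply: le_measure; rewrite ?inE//; first exact: measurableU.
move=> w Aw; have [Bw|nBw] := pselect (B w); first by left.
by right; apply: AB => /(_ Aw).
Qed.

(** * Small sets and crossing a level in a nonatomic space *)

Section nonatomic_probability.
Context (R : realType) (d : measure_display) (T : measurableType d).
Variable P : probability T R.
Hypothesis Pna : nonatomic P.

(** Nonatomicity splits [A] into two pieces of positive probability; the lighter one carries at most
    half of the mass. *)
Lemma nonatomic_halving (A : set T) : measurable A -> (0 < P A)%E ->
  exists B : set T, [/\ measurable B, B `<=` A, (0 < P B)%E &
    fine (P B) * 2 <= fine (P A)].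
Proof.
move=> mA A0; have [B [mB BA B0 BltA]] := Pna mA A0.
have mAB : measurable (A `\` B) by exact: measurableD.
have PE : fine (P A) = fine (P (A `\` B)) + fine (P B).
  rewrite -fineD ?fin_num_measure//; congr fine.
  by rewrite (measureDI P mA mB) (setIidr BA).
move: B0 BltA; rewrite (probability_fineK P mB) (probability_fineK P mA).
rewrite !lte_fin => B0 BltA.
have [h|h] := leP (fine (P B) * 2) (fine (P A)).
  by exists B; split => //; rewrite (probability_fineK P mB) lte_fin.
exists (A `\` B); split => //; last by lra.
by rewrite (probability_fineK P mAB) lte_fin; lra.
Qed.

Lemma nonatomic_small_subset (A : set T) (eps : R) :
  measurable A -> (0 < P A)%E -> 0 < eps ->
  exists B : set T, [/\ measurable B, B `<=` A, (0 < P B)%E &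
    fine (P B) <= eps].
Proof.
move=> mA A0 eps0.
have small n : exists B : set T, [/\ measurable B, B `<=` A, (0 < P B)%E &
    fine (P B) * 2 ^+ n <= 1].
  elim: n => [|n [B [mB BA B0 Bn]]].
    exists A; split => //; rewrite expr0 mulr1 -lee_fin -probability_fineK//.
    exact: probability_le1.
  have [C [mC CB C0 Ch]] := nonatomic_halving mB B0.
  exists C; split => //; first exact: subset_trans BA.
  by rewrite exprS mulrA (le_trans _ Bn)// ler_wpM2r.
(* This number of halvings suffices because [1/eps < n < 2^n] for [n = Num.bound eps^-1]. *)
have [B [mB BA B0 Bn]] := small (Num.bound eps^-1).
exists B; split => //.
have le2 : eps^-1 <= 2 ^+ Num.bound eps^-1.
  rewrite (le_trans (ltW (archi_boundP _)))// ?invr_ge0 1?ltW//.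
  by rewrite -natrX ltr_nat ltn_expl.
have B0' : 0 <= fine (P B) by rewrite fine_ge0.
have : fine (P B) * eps^-1 <= 1 by apply: le_trans Bn; rewrite ler_wpM2l.
by rewrite ler_pdivrMr ?mul1r.
Qed.

(* Otherwise the sets E with P (C `|` E) <= a whenever P C <= a include all the
   sets of probability at most P D; since they are stable under countable
   unions, a largest one exists, and it can be enlarged by a small subset of
   its complement. *)
Lemma nonatomic_crossing (a : R) (D : set T) :
  0 <= a < 1 -> measurable D -> (0 < P D)%E ->
  exists C : set T, [/\ measurable C, (P C <= a%:E)%E &
    (a%:E < P (C `|` D))%E].
Proof.
move=> /andP[a0 a1] mD D0; apply/not_existsP => nocross.
pose J (E : set T) := measurable E /\
  forall C, measurable C -> (P C <= a%:E -> P (C `|` E) <= a%:E)%E.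
have JD : J D.
  split=> // C mC Ca; rewrite leNgt; apply/negP => Da.
  by apply: (nocross C).
have JU E F : J E -> J F -> J (E `|` F).
  move=> [mE JE] [mF JF]; split; first exact: measurableU.
  by move=> C mC Ca; rewrite setUA; apply: JF; [exact: measurableU|exact: JE].
have Jsmall E : measurable E -> fine (P E) <= fine (P D) -> J E.
  move=> mE ED; split=> // C mC Ca.
  have mCD : measurable (C `|` D) by exact: measurableU.
  have mCDD : measurable ((C `|` D) `\` D) by exact: measurableD.
  have CDa : (P (C `|` D) <= a%:E)%E by exact: JD.2.
  (* Replacing D by E inside C `|` D does not increase the probability, so D
     can be put back. *)
  have : (P (((C `|` D) `\` D `|` E) `|` D) <= a%:E)%E.
    apply: JD.2; first exact: measurableU.
    rewrite (le_trans (measureU2 _ _ _))// (le_trans _ CDa)//.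
    rewrite (measureDI P mCD mD) setIUl setIid.
    rewrite (setUidr (@subIsetr _ C D)) leeD2l//.
    rewrite -[leLHS]fineK ?fin_num_measure//.
    by rewrite -[leRHS]fineK ?fin_num_measure// lee_fin.
  apply: le_trans; rewrite le_measure ?inE//.
  - exact: measurableU.
  - by apply: measurableU => //; exact: measurableU.
  move=> x [Cx|Ex]; last by left; right.
  by have [Dx|nDx] := pselect (D x); [right|left; left; split => //; left].
pose Q := [set fine (P E) | E in J].
have supQ : has_sup Q.
  split; first by exists (fine (P D)), D.
  exists 1 => _ [E [mE _] <-]; rewrite -lee_fin -probability_fineK//.
  exact: probability_le1.
(* Members of [J] whose probabilities approach the supremum; their union [U] will attain it. *)
have /choice[E EP] (n : nat) : exists E, J E /\ sup Q - n.+1%:R^-1 < fine (P E).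
  have n0 : 0 < (n.+1%:R : R)^-1 by rewrite invr_gt0.
  by have [_ [E JE <-] ?] := sup_adherent n0 supQ; exists E.
pose U := \bigcup_n E n.
have mE n : measurable (E n) by have [[]] := EP n.
have mU : measurable U by exact: bigcupT_measurable.
have JbigU n : J (\big[setU/set0]_(i < n) E i).
  elim: n => [|n IH]; last by rewrite big_ord_recr/=; exact: JU IH (EP n).1.
  by rewrite big_ord0; split => // C mC; rewrite setU0.
(* The sets [C] joined with finite partial unions increase to [C] joined with [U], so the bound [a]
   passes to the limit. *)
have JUU : J U.
  split=> // C mC Ca.
  have -> : C `|` U = \bigcup_n (C `|` \big[setU/set0]_(i < n) E i).
    apply/seteqP; split => [x [Cx|[n _ Enx]]|x [n _ [Cx|]]].
    - by exists 0%N => //; left.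
    - by exists n.+1 => //; right; rewrite big_ord_recr/=; right.
    - by left.
    - by rewrite -bigcup_mkord => -[k _ Ekx]; right; exists k.
  apply: measure_bigcup_nondecreasing_le => [n|m n mn|n].
  - by apply: measurableU => //; exact: (JbigU n).1.
  - apply/subsetPset/setUS; rewrite -!bigcup_mkord => x [k /= km Ekx].
    by exists k => //=; exact: leq_trans mn.
  - exact: (JbigU n).2.
have supU : sup Q <= fine (P U).
  rewrite leNgt; apply/negP => /ltr_add_invr[n]; have := (EP n).2.
  have : fine (P (E n)) <= fine (P U).
    by rewrite fine_le ?fin_num_measure// le_measure ?inE//; exact: bigcup_sup.
  by set r := n.+1%:R^-1; lra.
(* Testing [J U] on the empty set gives [P U <= a < 1], so there is room left outside [U]. *)
have Ua : (P U <= a%:E)%E.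
  by have := JUU.2 _ measurable0; rewrite measure0 lee_fin set0U; exact.
have mUC : measurable (~` U) by exact: measurableC.
have UC0 : (0 < P (~` U))%E.
  rewrite probability_setC// sube_gt0 ?fin_num_measure//.
  by rewrite (le_lt_trans Ua)// lte_fin.
have D0' : 0 < fine (P D) by rewrite -lte_fin -probability_fineK.
have [F [mF FU F0 FD]] := nonatomic_small_subset mUC UC0 D0'.
(* [F] belongs to [J] because [P F <= P D]; but then [P U + P F], with [P F > 0], exceeds the
   supremum. *)
have : fine (P (U `|` F)) <= sup Q.
  by apply: ub_le_sup; [exact: supQ.2|exists (U `|` F); first exact/JU/Jsmall].
rewrite measureU//; last by apply/seteqP; split => // x [Ux /FU].
rewrite fineD ?fin_num_measure//.
have : 0 < fine (P F) by rewrite -lte_fin -probability_fineK.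
lra.
Qed.

End nonatomic_probability.

(** * Linear combinations in L^p for all [p >= 0], and acceptance by Value-at-Risk *)

Section Lfun_ge0.
Context (R : realType) (d : measure_display) (T : measurableType d).
Variables (P : probability T R) (p : \bar R).
Hypothesis p0 : (0 <= p)%E.

Lemma Lfun_measurable (X : T -> R) : X \in Lfun P p -> measurable_fun setT X.
Proof. by move=> /sub_Lfun_mfun; rewrite inE. Qed.

Lemma Lfun_cst1 : cst 1 \in Lfun P p.
Proof.
apply/andP; split; rewrite inE/=; first exact: measurable_cst.
rewrite /finite_norm; case: p p0 => [r _| _|//].
  by rewrite Lnorm_cst1 [X in (X `^ _)%E]probability_setT poweR1r ltry.
rewrite Lnorm.unlock [X in (0 < X)%E]probability_setT lte01.
rewrite (_ : _ \o _ = cst 1%E).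
  by rewrite ess_sup_cst ?ltry ?[X in (0 < X)%E]probability_setT.
by apply/funext => x /=; rewrite normr1.
Qed.

(** Dropping the outer power [1/r] turns membership into integrability, which is treated uniformly
    in [r > 0], including [r < 1], where the norm has no triangle inequality. *)
Lemma finite_norm_integral_powR (X : T -> R) (r : R) : 0 < r ->
  measurable_fun setT X ->
  finite_norm P r%:E X <-> (\int[P]_x (`|X x| `^ r)%:E < +oo)%E.
Proof.
move=> r0 mX; rewrite /finite_norm Lnorm.unlock /=.
by split; [apply: lty_poweRy; rewrite gt_eqF ?invr_gt0|exact: poweR_lty].
Qed.

(* The quasi-norm constant: [(x + y) `^ r <= 2 `^ r * (x `^ r + y `^ r)] for
   every [r > 0], by [x + y <= 2 * max x y]. *)
Lemma Lfun_dominated (X Y Z : T -> R) (c : R) :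
  X \in Lfun P p -> Y \in Lfun P p -> measurable_fun setT Z -> 0 <= c ->
  (forall x, `|Z x| <= c * (`|X x| + `|Y x|)) -> Z \in Lfun P p.
Proof.
move=> LX LY mZ c0 ZXY; have mX := Lfun_measurable LX.
have mY := Lfun_measurable LY.
move: LX LY => /andP[_ +] /andP[_ +]; rewrite !inE/= => LX LY.
apply/andP; split; rewrite inE//=.
move: p0 LX LY; case: p => [r|_|//].
  rewrite lee_fin le_eqVlt => /predU1P[<- _ _|r0].
    (* At exponent 0 the convention [0^-1 = 0] makes the outer power trivial, so the norm is
       finite. *)
    by rewrite /finite_norm Lnorm.unlock /= invr0 poweRe0 ltry.
  move=> /(finite_norm_integral_powR r0 mX) LX.
  move=> /(finite_norm_integral_powR r0 mY) LY.
  apply/finite_norm_integral_powR => //.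
  have mp (W : T -> R) : measurable_fun setT W ->
      measurable_fun setT (fun x => (`|W x| `^ r)%:E).
    move=> mW; apply/measurable_EFinP.
    apply: (measurableT_comp (measurable_powR r)); exact: measurableT_comp.
  set k := (c * 2) `^ r.
  have k0 : 0 <= k by exact: powR_ge0.
  apply: (@le_lt_trans _ _ (\int[P]_x
      (k%:E * ((`|X x| `^ r)%:E + (`|Y x| `^ r)%:E)))%E); last first.
    rewrite ge0_integralZl//; last first.
      by move=> x _; rewrite -EFinD lee_fin addr_ge0// powR_ge0.
    - by apply: emeasurable_funD; exact: mp.
    rewrite ge0_integralD//; [|exact: mp|exact: mp].
    by rewrite lte_mul_pinfty ?lee_fin// lte_add_pinfty.
  apply: ge0_le_integral => //.
  - exact: mp.
  - by apply: measurable_funeM; apply: emeasurable_funD; exact: mp.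
  move=> x _; rewrite -EFinD -EFinM lee_fin.
  apply: (@le_trans _ _ ((c * 2 * Num.max `|X x| `|Y x|) `^ r)).
    rewrite ge0_ler_powR ?nnegrE ?(ltW r0) ?mulr_ge0 ?le_max ?normr_ge0//.
    rewrite (le_trans (ZXY x))// -mulrA ler_wpM2l// mulr_natl mulr2n.
    by rewrite lerD ?le_max ?lexx ?orbT.
  rewrite powRM ?mulr_ge0 ?le_max ?normr_ge0// ler_wpM2l//.
  by case: (leP `|X x| `|Y x|) => _; rewrite ?lerDl ?lerDr powR_ge0.
(* The case [p = +oo]: almost surely [|Z|] is at most [c] times the sum of the two essential
   suprema. *)
rewrite /finite_norm Lnorm.unlock [X in (0 < X)%E]probability_setT lte01.
move=> LX LY.
set sX := ess_sup _ _ in LX; set sY := ess_sup _ _ in LY.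
apply: (@le_lt_trans _ _ (c%:E * (sX + sY))%E); last first.
  by rewrite lte_mul_pinfty ?lee_fin// lte_add_pinfty.
apply/ess_supP.
have := ess_sup_ge P (abse \o (EFin \o X)).
have := ess_sup_ge P (abse \o (EFin \o Y)).
apply: filterS2 => x /= Yx Xx.
rewrite (@le_trans _ _ (c * (`|X x| + `|Y x|))%:E)// ?lee_fin//.
by rewrite EFinM EFinD lee_wpmul2l ?lee_fin// leeD.
Qed.

Lemma Lfun_addZ (X Y : T -> R) (c : R) : X \in Lfun P p -> Y \in Lfun P p ->
  (fun w => X w + c * Y w) \in Lfun P p.
Proof.
move=> LX LY; apply: (@Lfun_dominated X Y _ (1 + `|c|)) => //.
- apply: measurable_funD; first exact: Lfun_measurable.
  by apply: measurable_funM => //; exact: Lfun_measurable.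
move=> x; rewrite (le_trans (ler_normD _ _))// normrM.
rewrite mulrDl mul1r mulrDr.
have := mulr_ge0 (normr_ge0 c) (normr_ge0 (X x)); have := normr_ge0 (Y x).
lra.
Qed.

(** If the infimum is at most 0, every [e > 0] exceeds some admissible [m], and [X + e < 0] implies
    [X + m < 0]; then [e] tends to 0. Conversely, [m = 0] is admissible. *)
Lemma VaR_acceptanceP (alpha : R) (X : T -> R) : X \in Lfun P p ->
  VaR_acceptance P p alpha X <-> (P [set w | (X w < 0)%R] <= alpha%:E)%E.
Proof.
move=> LX; have mX := Lfun_measurable LX; split => [[_ VX]|Xa]; last first.
  split=> //; apply: ereal_inf_lbound; exists 0 => //=.
  by under eq_set do rewrite addr0.
apply: measure_ltr_le => // e e0.
have : (VaR P alpha X < e%:E)%E by rewrite (le_lt_trans VX).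
move=> /ereal_inf_lt[_ [m /= ma <-]]; rewrite lte_fin => me.
apply: le_trans ma; rewrite le_measure ?inE//.
- by apply: measurable_ltr => //; exact: measurable_funD.
- by apply: measurable_ltr => //; exact: measurable_funD.
by move=> w /=; lra.
Qed.

Lemma VaR_acceptance_mono (alpha : R) (X Y : T -> R) : Y \in Lfun P p ->
  {ae P, forall w, X w <= Y w} ->
  VaR_acceptance P p alpha X -> VaR_acceptance P p alpha Y.
Proof.
move=> LY XY AX; have LX := AX.1.
apply/VaR_acceptanceP => //; move/VaR_acceptanceP : AX => /(_ LX).
apply: le_trans; apply: le_measure_ae.
- by apply: measurable_ltr => //; exact: Lfun_measurable.
- by apply: measurable_ltr => //; exact: Lfun_measurable.
by apply: filterS XY => w /le_lt_trans; apply.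
Qed.

End Lfun_ge0.

(** * Cash subadditivity and its failure *)

Section payoff_below_price.
Context (R : realType) (d : measure_display) (T : measurableType d).
Variables (P : probability T R) (p : \bar R) (alpha : R) (S : traded_asset P p).
Hypothesis p0 : (0 <= p)%E.
Local Notation rho := (risk_measure (VaR_acceptance P p alpha) S).

Let mS : measurable_fun setT (payoff S).
Proof. exact: Lfun_measurable (payoff_Lfun S). Qed.

Lemma risk_measure_cash_subadditive :
  {ae P, forall w, price S <= payoff S w} -> cash_subadditive P p rho.
Proof.
move=> Sge; have S0 := price_gt0 S.
split=> [X Y LX LY XY|X l LX l0].
  apply: le_ereal_inf_tmp => _ [m Am <-]; apply: ereal_inf_lbound.
  exists m => //; apply: VaR_acceptance_mono Am => //.
    exact: Lfun_addZ (payoff_Lfun S).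
  by apply: filterS XY => w Xw; rewrite lerD2r.
(* If [m] makes [X + l] acceptable, then [m + l] makes [X] acceptable, since [l S_T / S_0 >= l]
   almost surely. *)
apply: le_ereal_inf_tmp => _ [m Am <-]; rewrite leeBlDr// -EFinD.
apply: ereal_inf_lbound; exists (m + l) => //.
apply: VaR_acceptance_mono Am => //.
  exact: Lfun_addZ (payoff_Lfun S).
apply: filterS Sge => w Sw; rewrite -addrA lerD2l mulrDl mulrDl addrC lerD2l.
by rewrite mulrAC -mulrA -[leLHS]mulr1 ler_pM2l// ler_pdivlMr// mul1r.
Qed.

Lemma risk_measure_not_cash_subadditive (e : R) (C : set T) :
  0 < e -> measurable C -> (P C <= alpha%:E)%E ->
  (alpha%:E < P (C `|` [set w | (payoff S w + e < price S)%R]))%E ->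
  ~ cash_subadditive P p rho.
Proof.
set B := [set w | _] => e0 mC Ca CBa [_ cash]; have S0 := price_gt0 S.
have mB : measurable B.
  by apply: measurable_ltr => //; exact: measurable_funD.
have mCB : measurable (C `|` B) by exact: measurableU.
(* This value exceeds 1 and still satisfies [K (S_0 - e) = S_0 - e^2 / S_0 < S_0], so investing [K]
   pays less than 1 on [B]. *)
pose K := 1 + e / price S.
have K0 : 0 < K by rewrite addr_gt0// divr_gt0.
pose X w := - \1_(C `|` B) w - K / price S * (payoff S w * \1_C w) : R.
have mX : measurable_fun setT X.
  apply: measurable_funB; first by apply: measurableT_comp.
  by apply: measurable_funM => //; exact: measurable_funM.
have KS0 : 0 <= K / price S by rewrite divr_ge0// ltW.
(* [|X| <= 1 + (K / S_0) |S_T|], which is dominated by [1 + K / S_0] times [1 + |S_T|]. *)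
have LX : X \in Lfun P p.
  apply: (Lfun_dominated p0 (Lfun_cst1 P p0) (payoff_Lfun S) mX
    (c := 1 + K / price S)); first by rewrite addr_ge0.
  move=> w; rewrite (le_trans (ler_normB _ _))// normrN normrM (ger0_norm KS0).
  rewrite normrM !indicE /cst normr1.
  have := mulr_ge0 KS0 (normr_ge0 (payoff S w)); have := normr_ge0 (payoff S w).
  by do 2 case: (_ \in _); rewrite /= ?normr1 ?normr0 ?mulr1 ?mulr0; lra.
have rho_ge : (K%:E <= rho X)%E.
  apply: le_ereal_inf_tmp => _ [m Am <-]; rewrite lee_fin leNgt.
  apply/negP => mK.
  have LXm := Lfun_addZ p0 (m / price S) LX (payoff_Lfun S).
  move/VaR_acceptanceP : Am => /(_ LXm); apply/negP; rewrite -ltNge.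
  apply: (lt_le_trans CBa); apply: le_measure_ae => //.
    by apply: measurable_ltr => //; exact: Lfun_measurable LXm.
  apply: filterS (payoff_ge0 S) => w Sw CBw /=.
  have mKS : m / price S * payoff S w <= K / price S * payoff S w.
    by rewrite ler_wpM2r// ler_wpM2r ?invr_ge0 ?(ltW S0) ?(ltW mK).
  rewrite /X !indicE (mem_set CBw).
  (* On [C] the terms in [S_T] sum to at most 0, leaving at most -1. Off [C] the point lies in [B],
     where the investment does not make up for the -1. *)
  have [Cw|nCw] := pselect (C w); first by rewrite (mem_set Cw) /=; lra.
  rewrite (memNset nCw) mulr0 mulr0 subr0 /=.
  have Bw : payoff S w + e < price S by case: CBw.
  suff : K / price S * payoff S w < 1 by lra.
  rewrite mulrAC ltr_pdivrMr// mul1r.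
  have : K * payoff S w < K * (price S - e) by rewrite ltr_pM2l//; lra.
  move/lt_le_trans; apply; rewrite /K mulrDl mul1r mulrBr divfK ?gt_eqF//.
  have : 0 <= e / price S * e.
    by rewrite !mulr_ge0 ?invr_ge0 ?(ltW e0) ?(ltW S0).
  lra.
have rho_le : (rho (fun w => (X w + 1)%R) <= 0)%E.
  apply: ereal_inf_lbound; exists 0 => //=.
  rewrite (_ : (fun w => _) = (fun w => X w + 1 * cst 1 w)); last first.
    by apply/funext => w; rewrite !mul0r addr0 mul1r.
  have LX1 := Lfun_addZ p0 1 LX (Lfun_cst1 P p0).
  apply/VaR_acceptanceP => //; apply: le_trans Ca; apply: le_measure_ae => //.
    by apply: measurable_ltr => //; exact: Lfun_measurable LX1.
  apply: nearW => w; apply: contraPP => nCw; apply/negP.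
  rewrite -leNgt /X !indicE (memNset nCw) mulr0 mulr0 subr0 mul1r /cst.
  by case: (_ \in _); rewrite /= ?addNr// oppr0 add0r.
have := cash X 1 LX ltr01; apply/negP; rewrite -ltNge.
apply: (le_lt_trans rho_le); rewrite lteBrDr// add0e.
by rewrite (lt_le_trans _ rho_ge)// lte_fin ltrDl divr_gt0.
Qed.

End payoff_below_price.

Theorem proposition5p5 (R : realType) (d : measure_display)
    (Omega : measurableType d) (P : probability Omega R) (p : \bar R)
    (alpha : R) (S : traded_asset P p) :
  nonatomic P -> (0 <= p)%E -> 0 < alpha < 1 ->
  cash_subadditive P p (risk_measure (VaR_acceptance P p alpha) S) <->
  P [set w | payoff S w < price S] = 0%E.
Proof.
move=> Pna p0 /andP[alpha0 alpha1].
have mS : measurable_fun setT (payoff S) := Lfun_measurable (payoff_Lfun S).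
have mlt : measurable [set w | payoff S w < price S] by exact: measurable_ltr.
split=> [cash|P0]; last first.
  apply: risk_measure_cash_subadditive => //.
  exists [set w | payoff S w < price S]; split => // w /=.
  by move=> /negP; rewrite -ltNge.
(* It suffices that [S_T + e < S_0] has probability 0 for each [e > 0]; the uniform gap [e] is what
   the counterexample needs. *)
apply/eqP; rewrite -measure_le0; apply: measure_ltr_le => // e e0.
rewrite leNgt; apply/negP => B0.
have mB : measurable [set w | payoff S w + e < price S].
  by apply: measurable_ltr => //; exact: measurable_funD.
have [|C [mC Ca CBa]] := nonatomic_crossing Pna (a := alpha) _ mB B0.
  by rewrite ltW.
exact: (risk_measure_not_cash_subadditive p0 e0 mC Ca CBa).
Qed.
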